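(* Let $(\mathcal K,[\cdot,\cdot])$ be a Krein space and let $T$ be a closed, densely defined linear operator in $\mathcal K$ with Krein space adjoint $T^{[*]}$. If $\rho(T^{[*]}T)\neq\emptyset$ and $\rho(TT^{[*]})\neq\emptyset$, then $T^{[*]}T$ and $TT^{[*]}$ are (densely defined and) selfadjoint operators in the Krein space $\mathcal K$, i.e. $(T^{[*]}T)^{[*]}=T^{[*]}T$ and $(TT^{[*]})^{[*]}=TT^{[*]}$.
   Context: $\mathcal K$ is equipped with any Banach (Hilbert) norm $\|\cdot\|$ for which $[\cdot,\cdot]$ is continuous (all such norms are equivalent). $T^{[*]}$ denotes the adjoint of $T$ with respect to $[\cdot,\cdot]$. Products have natural domains, e.g. $\operatorname{dom}(T^{[*]}T)=\{x\in\operatorname{dom}T: Tx\in\operatorname{dom}T^{[*]}\}$. For an operator $S$ in $\mathcal K$, $\rho(S)$ is the set of $\lambda\in\mathbb C$ with $S-\lambda:\operatorname{dom}S\to\mathcal K$ bijective and $(S-\lambda)^{-1}$ bounded. *)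

(* Defs.v *)
From Stdlib Require Import Reals ClassicalEpsilon.
Open Scope R_scope.
Set Implicit Arguments.

Record C := Cmk { re : R ; im : R }.
Definition C0 : C := Cmk 0 0.
Definition C1 : C := Cmk 1 0.
Definition Cadd (a b : C) : C := Cmk (re a + re b) (im a + im b).
Definition Cmul (a b : C) : C :=
  Cmk (re a * re b - im a * im b) (re a * im b + im a * re b).
Definition Cconj (a : C) : C := Cmk (re a) (- im a).

(* ---------- Krein spaces ----------
   A complex vector space with a Hermitian sesquilinear form [.,.] (linear in
   the first argument) admitting a fundamental decomposition K = K+ [+] K-:
   K+ and K- are subspaces with K+ /\ K- = {0}, K = K+ + K- (the component in
   K+ of x is Pp x), [K+,K-] = 0, (K+,[.,.]) and (K-,-[.,.]) are Hilbert
   spaces (positive definite and complete). *)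
Record KreinSpace := {
  kcar :> Type;
  kadd : kcar -> kcar -> kcar;
  kopp : kcar -> kcar;
  k0 : kcar;
  kscal : C -> kcar -> kcar;
  kaddA : forall x y z, kadd x (kadd y z) = kadd (kadd x y) z;
  kaddC : forall x y, kadd x y = kadd y x;
  kadd0 : forall x, kadd x k0 = x;
  kaddN : forall x, kadd x (kopp x) = k0;
  kscal1 : forall x, kscal C1 x = x;
  kscalA : forall a b x, kscal a (kscal b x) = kscal (Cmul a b) x;
  kscalDr : forall a x y, kscal a (kadd x y) = kadd (kscal a x) (kscal a y);
  kscalDl : forall a b x, kscal (Cadd a b) x = kadd (kscal a x) (kscal b x);
  form : kcar -> kcar -> C;
  formDl : forall x y z, form (kadd x y) z = Cadd (form x z) (form y z);
  formZl : forall a x z, form (kscal a x) z = Cmul a (form x z);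
  form_herm : forall x y, form y x = Cconj (form x y);
  Kp : kcar -> Prop;
  Km : kcar -> Prop;
  Kp0 : Kp k0;
  KpD : forall x y, Kp x -> Kp y -> Kp (kadd x y);
  KpZ : forall a x, Kp x -> Kp (kscal a x);
  Km0 : Km k0;
  KmD : forall x y, Km x -> Km y -> Km (kadd x y);
  KmZ : forall a x, Km x -> Km (kscal a x);
  Pp : kcar -> kcar;
  Pp_Kp : forall x, Kp (Pp x);
  Pp_Km : forall x, Km (kadd x (kopp (Pp x)));
  Kp_Km_0 : forall x, Kp x -> Km x -> x = k0;
  Kp_Km_orth : forall x y, Kp x -> Km y -> form x y = C0;
  Kp_pos : forall x, Kp x -> x <> k0 -> 0 < re (form x x);
  Km_neg : forall x, Km x -> x <> k0 -> re (form x x) < 0;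
  Kp_complete : forall u : nat -> kcar, (forall n, Kp (u n)) ->
    (forall eps, 0 < eps -> exists N, forall n m, (N <= n)%nat -> (N <= m)%nat ->
       sqrt (re (form (kadd (u n) (kopp (u m))) (kadd (u n) (kopp (u m))))) < eps) ->
    exists l, Kp l /\ forall eps, 0 < eps -> exists N, forall n, (N <= n)%nat ->
       sqrt (re (form (kadd (u n) (kopp l)) (kadd (u n) (kopp l)))) < eps;
  Km_complete : forall u : nat -> kcar, (forall n, Km (u n)) ->
    (forall eps, 0 < eps -> exists N, forall n m, (N <= n)%nat -> (N <= m)%nat ->
       sqrt (- re (form (kadd (u n) (kopp (u m))) (kadd (u n) (kopp (u m))))) < eps) ->
    exists l, Km l /\ forall eps, 0 < eps -> exists N, forall n, (N <= n)%nat ->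
       sqrt (- re (form (kadd (u n) (kopp l)) (kadd (u n) (kopp l)))) < eps
}.

Arguments kadd {k}. Arguments kopp {k}. Arguments k0 {k}. Arguments kscal {k}.
Arguments form {k}. Arguments Pp {k}.

Section Ops.
Variable K : KreinSpace.

Definition ksub (x y : K) : K := kadd x (kopp y).
Definition Pm (x : K) : K := ksub x (Pp x).

(* The Hilbert norm induced by the fundamental decomposition:
   ||x||^2 = [x+,x+] - [x-,x-]  (all admissible norms are equivalent). *)
Definition knorm (x : K) : R :=
  sqrt (re (form (Pp x) (Pp x)) - re (form (Pm x) (Pm x))).

Definition kdist (x y : K) : R := knorm (ksub x y).

Definition converges (u : nat -> K) (l : K) : Prop :=
  forall eps, 0 < eps -> exists N, forall n, (N <= n)%nat -> kdist (u n) l < eps.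

Record Op := mkOp { dom : K -> Prop ; app : K -> K }.

Definition linear_op (T : Op) : Prop :=
  dom T k0 /\
  (forall x y, dom T x -> dom T y -> dom T (kadd x y) /\
       app T (kadd x y) = kadd (app T x) (app T y)) /\
  (forall a x, dom T x -> dom T (kscal a x) /\ app T (kscal a x) = kscal a (app T x)).

Definition densely_defined (T : Op) : Prop :=
  forall x eps, 0 < eps -> exists y, dom T y /\ kdist x y < eps.

Definition closed_op (T : Op) : Prop :=
  forall (u : nat -> K) x y, (forall n, dom T (u n)) -> converges u x ->
    converges (fun n => app T (u n)) y -> dom T x /\ app T x = y.

Definition op_comp (S T : Op) : Op :=
  mkOp (fun x => dom T x /\ dom S (app T x)) (fun x => app S (app T x)).

Definition adj_rel (T : Op) (y z : K) : Prop :=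
  forall x, dom T x -> form (app T x) y = form x z.

Definition adj (T : Op) : Op :=
  mkOp (fun y => exists z, adj_rel T y z)
       (fun y => epsilon (inhabits k0) (adj_rel T y)).

Definition op_eq (S T : Op) : Prop :=
  (forall x, dom S x <-> dom T x) /\ (forall x, dom S x -> app S x = app T x).

Definition in_resolvent (S : Op) (lam : C) : Prop :=
  (forall x y, dom S x -> dom S y ->
     ksub (app S x) (kscal lam x) = ksub (app S y) (kscal lam y) -> x = y) /\
  (forall y, exists x, dom S x /\ ksub (app S x) (kscal lam x) = y) /\
  (exists c, forall x, dom S x -> knorm x <= c * knorm (ksub (app S x) (kscal lam x))).

Definition resolvent_nonempty (S : Op) : Prop := exists lam, in_resolvent S lam.

Definition selfadjoint (S : Op) : Prop :=
  densely_defined S /\ op_eq (adj S) S.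

End Ops.

Arguments mkOp {K}.

(* Main.v *)
Require Import Defs.
From Stdlib Require Import Reals.
From Stdlib Require Import Lra Lia Classical ClassicalEpsilon.

(** If [lam] lies in both resolvent sets, then [R = (T^+ T - lam)^-1] and
    [Q = (T T^+ - lam)^-1] satisfy [R T^+ = T^+ Q] on [dom T^+] and
    [T^+ Q T = 1 + lam R] on [dom T], and uniform boundedness shows that [T R] and
    [T^+ Q] are bounded.  Since [T^++ = T], these relations put [R^+ v] in
    [dom (T^+ T)] with [(T^+ T - conj lam) R^+ v = v].  Surjectivity of
    [T^+ T - conj lam] gives both the density of [dom (T^+ T)] and the inclusion of
    the adjoint of [T^+ T] in [T^+ T].  A common [lam] exists because each nonzero
    point of one resolvent set belongs to the other; if neither set contains a
    nonzero point, both equal [{0}]. *)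

(** In a Hilbert space, [[T x, T x] >= 0] makes [1 + T^+ T] invertible, and selfadjointness follows
    as in von Neumann's theorem. An indefinite form gives no such positivity, so the resolvent
    points have to supply the invertibility. Symmetry of [T^+ T] is immediate; density of the domain
    and maximality are the issue. Before density is known the adjoint of [T^+ T] need not be an
    operator, so the argument works with the adjoint of the bounded, everywhere defined [R].

    To place [R^+ v] in [dom T = dom T^++], the functional [w |-> [T^+ w, R^+ v] = [R T^+ w, v]]
    must be bounded. Rewriting [R T^+] as the bounded operator [T^+ Q] does this, and it is here
    that the second product enters, at the same [lam]. *)

Lemma nonneg_quadratic_discr (a b c : R) :
  (forall t, 0 <= a * t * t + 2 * b * t + c) -> b * b <= a * c.
Proof.
  intros H.
  destruct (Req_dec a 0) as [-> | Ha].
  - destruct (Req_dec b 0) as [-> | Hb]; [lra |].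
    specialize (H (- (c + 1) / (2 * b))).
    replace (0 * (- (c + 1) / (2 * b)) * (- (c + 1) / (2 * b)) +
             2 * b * (- (c + 1) / (2 * b)) + c) with (-1) in H by (field; lra).
    lra.
  - assert (0 < a).
    { destruct (Rlt_le_dec 0 a) as [|Hn]; [assumption | exfalso].
      pose proof (H 0) as H0.
      (* For [a < 0] this point is far enough out for the quadratic to be negative; the final [+ 1]
         gives [s >= 1], so that [c <= c * s]. *)
      set (s := (1 + 2 * Rabs b + c) / - a + 1).
      assert (Hs : - a * s = 1 + 2 * Rabs b + c - a) by (unfold s; field; lra).
      assert (Hs1 : 1 <= s).
      { unfold s. assert (0 <= (1 + 2 * Rabs b + c) / - a); [|lra].
        apply Rmult_le_pos; [pose proof (Rabs_pos b); lra|].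
        left; apply Rinv_0_lt_compat; lra. }
      pose proof (H s) as Ht.
      pose proof (Rle_abs b).
      replace (a * s * s) with (- (1 + 2 * Rabs b + c - a) * s) in Ht
        by (rewrite <- Hs; ring).
      nra. }
    specialize (H (- b / a)).
    replace (a * (- b / a) * (- b / a) + 2 * b * (- b / a) + c)
      with ((a * c - b * b) / a) in H by (field; lra).
    apply Rmult_le_compat_l with (r := a) in H; [|lra].
    replace (a * ((a * c - b * b) / a)) with (a * c - b * b) in H by (field; lra).
    lra.
Qed.

Lemma eventually_inv_lt (eps : R) : 0 < eps -> exists N, forall n, (N <= n)%nat -> / (INR n + 1) < eps.
Proof.
  intros He. destruct (archimed_cor1 eps He) as [N [HN HN0]].
  exists N. intros n Hn. apply Rle_lt_trans with (/ INR N); [|exact HN].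
  apply Rinv_le_contravar; [apply lt_0_INR; lia|].
  apply le_INR in Hn. lra.
Qed.

#[local] Arguments ksub {K} x y.

(** * Algebra of the indefinite form and its nondegeneracy *)

Section Krein.
Variable K : KreinSpace.
Implicit Types x y z w : K.

(** Estimates and duality arguments run on this real symmetric bilinear form; [adj_rel_re] later
    returns to complex identities. *)
Definition rf x y : R := re (form x y).
Definition imf x y : R := im (form x y).
Definition rs (t : R) x : K := kscal (Cmk t 0) x.

Lemma rfDl x y z : rf (kadd x y) z = rf x z + rf y z.
Proof. unfold rf. rewrite formDl. reflexivity. Qed.

Lemma imfDl x y z : imf (kadd x y) z = imf x z + imf y z.
Proof. unfold imf. rewrite formDl. reflexivity. Qed.

Lemma rfZl a x z : rf (kscal a x) z = re a * rf x z - im a * imf x z.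
Proof. unfold rf. rewrite formZl. reflexivity. Qed.

Lemma imfZl a x z : imf (kscal a x) z = re a * imf x z + im a * rf x z.
Proof. unfold imf. rewrite formZl. reflexivity. Qed.

Lemma rfC x y : rf x y = rf y x.
Proof. unfold rf. rewrite (form_herm K y x). reflexivity. Qed.

Lemma imfC x y : imf x y = - imf y x.
Proof. unfold imf. rewrite (form_herm K y x). reflexivity. Qed.

Lemma rf0l z : rf k0 z = 0.
Proof. pose proof (rfDl k0 k0 z) as H. rewrite kadd0 in H. lra. Qed.

Lemma imf0l z : imf k0 z = 0.
Proof. pose proof (imfDl k0 k0 z) as H. rewrite kadd0 in H. lra. Qed.

Lemma rfNl x z : rf (kopp x) z = - rf x z.
Proof. pose proof (rfDl x (kopp x) z) as H. rewrite kaddN, rf0l in H. lra. Qed.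

Lemma imfNl x z : imf (kopp x) z = - imf x z.
Proof. pose proof (imfDl x (kopp x) z) as H. rewrite kaddN, imf0l in H. lra. Qed.

Lemma rfBl x y z : rf (ksub x y) z = rf x z - rf y z.
Proof. unfold ksub. rewrite rfDl, rfNl. ring. Qed.

Lemma imfBl x y z : imf (ksub x y) z = imf x z - imf y z.
Proof. unfold ksub. rewrite imfDl, imfNl. ring. Qed.

Lemma rfsl t x z : rf (rs t x) z = t * rf x z.
Proof. unfold rs. rewrite rfZl. simpl. ring. Qed.

Lemma imfsl t x z : imf (rs t x) z = t * imf x z.
Proof. unfold rs. rewrite imfZl. simpl. ring. Qed.

Lemma rfDr x y z : rf z (kadd x y) = rf z x + rf z y.
Proof. rewrite !(rfC z). apply rfDl. Qed.

Lemma rfNr x z : rf z (kopp x) = - rf z x.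
Proof. rewrite !(rfC z). apply rfNl. Qed.

Lemma rfBr x y z : rf z (ksub x y) = rf z x - rf z y.
Proof. rewrite !(rfC z). apply rfBl. Qed.

Lemma rf0r z : rf z k0 = 0.
Proof. rewrite rfC. apply rf0l. Qed.

Lemma rfZr a x z : rf z (kscal a x) = re a * rf z x + im a * imf z x.
Proof. rewrite rfC, rfZl, (rfC x z), (imfC x z). ring. Qed.

Lemma rfsr t x z : rf z (rs t x) = t * rf z x.
Proof. rewrite !(rfC z). apply rfsl. Qed.

Lemma rf_conj a x y : rf (kscal a x) y = rf x (kscal (Cconj a) y).
Proof. rewrite rfZl, rfZr. simpl. ring. Qed.

Lemma kadd_cancel x y z : kadd x y = kadd x z -> y = z.
Proof.
  intros H. rewrite <- (kadd0 K y), <- (kadd0 K z), <- (kaddN K x).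
  rewrite !kaddA, (kaddC K y x), (kaddC K z x), H. reflexivity.
Qed.

Lemma kadd_sub x y : kadd y (ksub x y) = x.
Proof.
  unfold ksub. rewrite (kaddC K x), kaddA, kaddN, (kaddC K k0), kadd0. reflexivity.
Qed.

Lemma kscal0 x : kscal C0 x = k0.
Proof.
  apply kadd_cancel with (kscal C0 x). rewrite <- kscalDl, kadd0.
  f_equal. unfold C0, Cadd. simpl. f_equal; ring.
Qed.

Lemma kopp_scal x : kopp x = kscal (Cmk (-1) 0) x.
Proof.
  apply kadd_cancel with x. rewrite kaddN.
  transitivity (kadd (kscal Defs.C1 x) (kscal (Cmk (-1) 0) x)); [|rewrite kscal1; reflexivity].
  rewrite <- kscalDl, <- (kscal0 x).
  f_equal. unfold C0, Defs.C1, Cadd. simpl. f_equal; ring.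
Qed.

Lemma KpN x : Kp K x -> Kp K (kopp x).
Proof. rewrite kopp_scal. apply KpZ. Qed.

Lemma KmN x : Km K x -> Km K (kopp x).
Proof. rewrite kopp_scal. apply KmZ. Qed.

Lemma Pm_Km x : Km K (Pm K x).
Proof. apply Pp_Km. Qed.

Lemma rf_Kp_Km x y : Kp K x -> Km K y -> rf x y = 0.
Proof. intros Hx Hy. unfold rf. rewrite (Kp_Km_orth K x y Hx Hy). reflexivity. Qed.

Lemma rf_nondeg x : (forall w, rf x w = 0) -> x = k0.
Proof.
  intros H.
  assert (Hx : x = kadd (Pp x) (Pm K x)) by (symmetry; apply kadd_sub).
  assert (H1 : Pp x = k0).
  { apply NNPP; intros Hn. pose proof (Kp_pos K (Pp_Kp K x) Hn) as Hp.
    pose proof (H (Pp x)) as H0. rewrite Hx, rfDl in H0 at 1.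
    rewrite (rfC (Pm K x)), (rf_Kp_Km _ _ (Pp_Kp K x) (Pm_Km x)) in H0.
    unfold rf in H0. lra. }
  assert (H2 : Pm K x = k0).
  { apply NNPP; intros Hn. pose proof (Km_neg K (Pm_Km x) Hn) as Hp.
    pose proof (H (Pm K x)) as H0. rewrite Hx, rfDl in H0 at 1.
    rewrite (rf_Kp_Km _ _ (Pp_Kp K x) (Pm_Km x)) in H0.
    unfold rf in H0. lra. }
  rewrite Hx, H1, H2. apply kadd0.
Qed.

Lemma rf_ext x y : (forall w, rf x w = rf y w) -> x = y.
Proof.
  intros H.
  assert (H0 : ksub x y = k0).
  { apply rf_nondeg. intros w. rewrite rfBl, H. ring. }
  rewrite <- (kadd_sub x y), H0. apply kadd0.
Qed.

End Krein.

Arguments rf {K}. Arguments imf {K}. Arguments rs {K}.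

#[local] Hint Rewrite rfDl rfBl rfNl rfsl rf0l rfZl imfDl imfBl imfNl imfsl imf0l imfZl
  : form_left.
#[local] Hint Rewrite rfDl rfBl rfNl rfsl rf0l rfDr rfBr rfNr rfsr rf0r : form_bilin.

(* Linear identities between vectors become identities between real numbers
   once paired with an arbitrary vector, the form being nondegenerate. *)
Ltac vec_ring :=
  apply rf_ext; let w := fresh "w" in intro w; unfold Pm; autorewrite with form_left;
  simpl re; simpl im; ring.

(** * The Hilbert inner product of the fundamental decomposition, and completeness *)

Section Hilbert.
Variable K : KreinSpace.
Implicit Types x y z w : K.

Lemma ksub_rs x y : ksub x y = kadd x (rs (-1) y).
Proof. vec_ring. Qed.

(** [Pp] is given only as a function; its linearity is derived from this uniqueness. Two candidates
    differ by a vector lying in both [Kp] and [Km]. *)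
Lemma Pp_unique x a b : Kp K a -> Km K b -> x = kadd a b -> Pp x = a.
Proof.
  intros Ha Hb Hx.
  assert (H : ksub (Pp x) a = k0).
  { apply Kp_Km_0.
    - apply KpD; [apply Pp_Kp | apply KpN, Ha].
    - replace (ksub (Pp x) a) with (kadd b (kopp (Pm K x))).
      + apply KmD; [exact Hb | apply KmN, Pm_Km].
      + rewrite Hx. vec_ring. }
  rewrite <- (kadd_sub K (Pp x) a), H. apply kadd0.
Qed.

Lemma PpD x y : Pp (kadd x y) = kadd (Pp x) (Pp y).
Proof.
  apply Pp_unique with (kadd (Pm K x) (Pm K y)).
  - apply KpD; apply Pp_Kp.
  - apply KmD; apply Pm_Km.
  - vec_ring.
Qed.

Lemma PpZ a x : Pp (kscal a x) = kscal a (Pp x).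
Proof.
  apply Pp_unique with (kscal a (Pm K x)).
  - apply KpZ, Pp_Kp.
  - apply KmZ, Pm_Km.
  - vec_ring.
Qed.

Lemma Pps t x : Pp (rs t x) = rs t (Pp x).
Proof. apply PpZ. Qed.

Lemma PpB x y : Pp (ksub x y) = ksub (Pp x) (Pp y).
Proof. rewrite !ksub_rs, PpD, Pps. reflexivity. Qed.

Definition ip x y : R := rf (Pp x) (Pp y) - rf (Pm K x) (Pm K y).

(** The fundamental symmetry, which translates between [rf] and the inner product [ip]. *)
Definition J x : K := ksub (Pp x) (Pm K x).

Lemma ipDl x y z : ip (kadd x y) z = ip x z + ip y z.
Proof. unfold ip, Pm. rewrite PpD. autorewrite with form_bilin. ring. Qed.

Lemma ipBl x y z : ip (ksub x y) z = ip x z - ip y z.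
Proof. unfold ip, Pm. rewrite PpB. autorewrite with form_bilin. ring. Qed.

Lemma ipsl t x z : ip (rs t x) z = t * ip x z.
Proof. unfold ip, Pm. rewrite Pps. autorewrite with form_bilin. ring. Qed.

Lemma ipC x y : ip x y = ip y x.
Proof. unfold ip. rewrite (rfC K (Pp x)), (rfC K (Pm K x)). reflexivity. Qed.

Lemma ipDr x y z : ip z (kadd x y) = ip z x + ip z y.
Proof. rewrite !(ipC z). apply ipDl. Qed.

Lemma ipBr x y z : ip z (ksub x y) = ip z x - ip z y.
Proof. rewrite !(ipC z). apply ipBl. Qed.

Lemma ipsr t x z : ip z (rs t x) = t * ip z x.
Proof. rewrite !(ipC z). apply ipsl. Qed.

Lemma rf_Pp_Pm x y : rf (Pp x) (Pm K y) = 0.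
Proof. apply rf_Kp_Km; [apply Pp_Kp | apply Pm_Km]. Qed.

Lemma ip_rf_J x y : ip x y = rf x (J y).
Proof.
  pose proof (rf_Pp_Pm x y) as H1. pose proof (rf_Pp_Pm y x) as H2.
  rewrite rfC in H2. unfold ip, J, Pm in *. autorewrite with form_bilin in *. lra.
Qed.

Lemma J_Pp x : Pp (J x) = Pp x.
Proof.
  apply Pp_unique with (kopp (Pm K x)); [apply Pp_Kp | apply KmN, Pm_Km |].
  unfold J. vec_ring.
Qed.

Lemma JK x : J (J x) = x.
Proof.
  unfold J at 1, Pm. rewrite J_Pp. unfold J. vec_ring.
Qed.

Lemma rf_ip_J x y : rf x y = ip x (J y).
Proof. rewrite ip_rf_J, JK. reflexivity. Qed.

Lemma ip_J x y : ip (J x) (J y) = ip x y.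
Proof. rewrite ip_rf_J, JK, rfC, <- ip_rf_J. apply ipC. Qed.

Lemma ip_ge0 x : 0 <= ip x x.
Proof.
  unfold ip.
  assert (0 <= rf (Pp x) (Pp x)).
  { destruct (classic (Pp x = k0)) as [-> | H]; [rewrite rf0l; lra |].
    left. apply Kp_pos; [apply Pp_Kp | exact H]. }
  assert (rf (Pm K x) (Pm K x) <= 0); [|lra].
  destruct (classic (Pm K x = k0)) as [-> | H']; [rewrite rf0l; lra |].
  left. apply Km_neg; [apply Pm_Km | exact H'].
Qed.

Lemma cauchy_schwarz x y : ip x y * ip x y <= ip x x * ip y y.
Proof.
  apply nonneg_quadratic_discr. intros t.
  pose proof (ip_ge0 (kadd (rs t x) y)) as H.
  rewrite ipDl, !ipDr, !ipsl, !ipsr, (ipC y x) in H. lra.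
Qed.

Lemma ip_eq0 x : ip x x = 0 -> x = k0.
Proof.
  intros H. apply rf_nondeg. intros w. rewrite rf_ip_J.
  pose proof (cauchy_schwarz x (J w)) as H1. rewrite H in H1. nra.
Qed.

Lemma knormE x : knorm K x = sqrt (ip x x).
Proof. reflexivity. Qed.

Lemma knorm_ge0 x : 0 <= knorm K x.
Proof. apply sqrt_pos. Qed.

Lemma knorm_sq x : knorm K x * knorm K x = ip x x.
Proof. rewrite knormE. apply sqrt_sqrt, ip_ge0. Qed.

Lemma knorm_le x r : 0 <= r -> ip x x <= r * r -> knorm K x <= r.
Proof.
  intros Hr H. rewrite knormE, <- (sqrt_square r Hr). apply sqrt_le_1_alt, H.
Qed.

Lemma ip_le x y : Rabs (ip x y) <= knorm K x * knorm K y.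
Proof.
  rewrite <- (Rabs_pos_eq (knorm K x * knorm K y)).
  - apply Rsqr_le_abs_0. unfold Rsqr. pose proof (cauchy_schwarz x y) as H.
    rewrite <- !knorm_sq in H. nra.
  - apply Rmult_le_pos; apply knorm_ge0.
Qed.

Lemma knorm_J x : knorm K (J x) = knorm K x.
Proof. rewrite !knormE, ip_J. reflexivity. Qed.

Lemma rf_le x y : Rabs (rf x y) <= knorm K x * knorm K y.
Proof. rewrite rf_ip_J, <- (knorm_J y). apply ip_le. Qed.

Lemma knormD x y : knorm K (kadd x y) <= knorm K x + knorm K y.
Proof.
  pose proof (knorm_ge0 x). pose proof (knorm_ge0 y).
  apply knorm_le; [lra|].
  rewrite ipDl, !ipDr, (ipC y x), <- !knorm_sq.
  pose proof (ip_le x y). pose proof (Rle_abs (ip x y)). nra.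
Qed.

Lemma knormZ a x :
  knorm K (kscal a x) = sqrt (re a * re a + im a * im a) * knorm K x.
Proof.
  rewrite !knormE, <- sqrt_mult_alt by nra. f_equal.
  unfold ip, Pm. rewrite PpZ.
  replace (ksub (kscal a x) (kscal a (Pp x))) with (kscal a (ksub x (Pp x))) by vec_ring.
  rewrite !rfZl, !rfZr, !imfC with (x := _) (y := kscal _ _).
  rewrite !imfZl.
  (* Hermitian symmetry makes [form] real on the diagonal, so the imaginary terms vanish. *)
  pose proof (imfC K (Pp x) (Pp x)). pose proof (imfC K (ksub x (Pp x)) (ksub x (Pp x))).
  replace (imf (Pp x) (Pp x)) with 0 by lra.
  replace (imf (ksub x (Pp x)) (ksub x (Pp x))) with 0 by lra. ring.
Qed.

Lemma knorms t x : knorm K (rs t x) = Rabs t * knorm K x.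
Proof.
  unfold rs. rewrite knormZ. simpl.
  replace (t * t + 0 * 0) with (Rsqr t) by (unfold Rsqr; ring).
  rewrite sqrt_Rsqr_abs. reflexivity.
Qed.

Lemma knormBC x y : knorm K (ksub x y) = knorm K (ksub y x).
Proof.
  replace (ksub x y) with (rs (-1) (ksub y x)) by vec_ring.
  rewrite knorms, Rabs_left by lra. ring.
Qed.

Lemma knorm_triangle x y z :
  knorm K (ksub x z) <= knorm K (ksub x y) + knorm K (ksub y z).
Proof.
  replace (ksub x z) with (kadd (ksub x y) (ksub y z)) by vec_ring. apply knormD.
Qed.

Definition cauchy (u : nat -> K) : Prop :=
  forall eps, 0 < eps -> exists N, forall n m, (N <= n)%nat -> (N <= m)%nat ->
    knorm K (ksub (u n) (u m)) < eps.

(** Each component is no longer than the whole vector, so both component sequences are Cauchy, and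
    their limits in [Kp] and [Km] add up to the limit. *)
Lemma krein_complete (u : nat -> K) : cauchy u -> exists l, converges K u l.
Proof.
  intros Hu.
  assert (Hp : forall x, re (form (Pp x) (Pp x)) <= ip x x).
  { intros x. pose proof (ip_ge0 (ksub x (Pp x))) as H. unfold ip in *.
    assert (HP : Pp (ksub x (Pp x)) = k0).
    { apply Pp_unique with (ksub x (Pp x)); [apply Kp0 | apply Pm_Km | vec_ring]. }
    rewrite HP, rf0l in H.
    replace (Pm K (ksub x (Pp x))) with (Pm K x) in H
      by (unfold Pm at 2; rewrite HP; vec_ring).
    unfold rf in *. lra. }
  assert (Hm : forall x, - re (form (Pm K x) (Pm K x)) <= ip x x).
  { intros x. unfold ip.
    assert (0 <= rf (Pp x) (Pp x)); [|unfold rf in *; lra].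
    destruct (classic (Pp x = k0)) as [-> | H']; [rewrite rf0l; lra |].
    left. apply Kp_pos; [apply Pp_Kp | exact H']. }
  destruct (Kp_complete K (fun n => Pp (u n))) as [lp [Hlp Hlpc]].
  { intros n. apply Pp_Kp. }
  { intros eps He. destruct (Hu eps He) as [N HN]. exists N. intros n m Hn Hm'.
    eapply Rle_lt_trans; [|apply (HN n m Hn Hm')]. rewrite knormE.
    apply sqrt_le_1_alt. specialize (Hp (ksub (u n) (u m))). rewrite PpB in Hp. exact Hp. }
  destruct (Km_complete K (fun n => Pm K (u n))) as [lm [Hlm Hlmc]].
  { intros n. apply Pm_Km. }
  { intros eps He. destruct (Hu eps He) as [N HN]. exists N. intros n m Hn Hm'.
    eapply Rle_lt_trans; [|apply (HN n m Hn Hm')]. rewrite knormE.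
    apply sqrt_le_1_alt. specialize (Hm (ksub (u n) (u m))).
    replace (kadd (Pm K (u n)) (kopp (Pm K (u m)))) with (Pm K (ksub (u n) (u m)));
      [exact Hm|]. unfold Pm. rewrite PpB. vec_ring. }
  exists (kadd lp lm). intros eps He.
  destruct (Hlpc (eps / 2)) as [N1 H1]; [lra|].
  destruct (Hlmc (eps / 2)) as [N2 H2]; [lra|].
  exists (N1 + N2)%nat. intros n Hn.
  specialize (H1 n ltac:(lia)). specialize (H2 n ltac:(lia)).
  fold (ksub (Pp (u n)) lp) (ksub (Pm K (u n)) lm) in *.
  set (a := ksub (Pp (u n)) lp) in *. set (b := ksub (Pm K (u n)) lm) in *.
  assert (HP : Pp (ksub (u n) (kadd lp lm)) = a).
  { apply Pp_unique with b.
    - apply KpD; [apply Pp_Kp | apply KpN, Hlp].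
    - apply KmD; [apply Pm_Km | apply KmN, Hlm].
    - unfold a, b. vec_ring. }
  assert (HM : Pm K (ksub (u n) (kadd lp lm)) = b).
  { unfold Pm. rewrite HP. unfold a, b. vec_ring. }
  unfold kdist.
  set (d := ksub (u n) (kadd lp lm)) in *.
  assert (Hd : ip d d = re (form a a) + - re (form b b)).
  { unfold ip. rewrite HP, HM. unfold rf. ring. }
  rewrite <- HP in H1. rewrite <- HM in H2.
  assert (Ha : 0 <= re (form (Pp d) (Pp d))).
  { destruct (classic (Pp d = k0)) as [-> | H']; [change (0 <= rf (@k0 K) k0); rewrite rf0l; lra |].
    left. apply Kp_pos; [apply Pp_Kp | exact H']. }
  assert (Hb : 0 <= - re (form (Pm K d) (Pm K d))).
  { destruct (classic (Pm K d = k0)) as [-> | H'].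
    - change (0 <= - rf (@k0 K) k0). rewrite rf0l. lra.
    - pose proof (Km_neg K (Pm_Km K d) H'). lra. }
  rewrite <- HP, <- HM in Hd.
  pose proof (sqrt_sqrt _ Ha). pose proof (sqrt_sqrt _ Hb).
  pose proof (sqrt_pos (re (form (Pp d) (Pp d)))).
  pose proof (sqrt_pos (- re (form (Pm K d) (Pm K d)))).
  eapply Rle_lt_trans; [apply knorm_le with
    (r := sqrt (re (form (Pp d) (Pp d))) + sqrt (- re (form (Pm K d) (Pm K d))))|];
    [lra | rewrite Hd; nra | lra].
Qed.

End Hilbert.

(** * Riesz representation, density criteria and uniform boundedness *)

Section Analysis.
Variable K : KreinSpace.
Implicit Types x y z w : K.

Local Notation norm := (knorm K).

Lemma Un_cv_ip (u : nat -> K) l x :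
  converges K u l -> Un_cv (fun n => ip K x (u n)) (ip K x l).
Proof.
  intros Hu eps He.
  destruct (Hu (eps / (norm x + 1))) as [N HN].
  { pose proof (knorm_ge0 K x). apply Rdiv_lt_0_compat; lra. }
  exists N. intros n Hn. unfold Rdist. rewrite <- ipBr.
  specialize (HN n Hn). unfold kdist in HN.
  pose proof (knorm_ge0 K x). pose proof (knorm_ge0 K (ksub (u n) l)).
  apply Rle_lt_trans with (1 := ip_le K x (ksub (u n) l)).
  apply Rle_lt_trans with ((norm x + 1) * norm (ksub (u n) l)); [nra|].
  apply Rmult_lt_compat_l with (r := norm x + 1) in HN; [|lra].
  replace ((norm x + 1) * (eps / (norm x + 1))) with eps in HN by (field; lra).
  exact HN.
Qed.

(* A Riesz representation without completeness: the form [B] is only assumed to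
   be a real inner product on the subspace [V], and the representing vector is
   replaced by a minimizing sequence of [B x x - 2 f x]. *)
Lemma riesz_sequence (V : K -> Prop) (B : K -> K -> R) (f : K -> R) (c : R) :
  V k0 -> (forall x y, V x -> V y -> V (kadd x y)) -> (forall t x, V x -> V (rs t x)) ->
  (forall x y, V x -> V y -> B x y = B y x) ->
  (forall x y z, V x -> V y -> V z -> B (kadd x y) z = B x z + B y z) ->
  (forall t x z, V x -> V z -> B (rs t x) z = t * B x z) ->
  (forall x, V x -> 0 <= B x x) ->
  (forall x y, V x -> V y -> f (kadd x y) = f x + f y) ->
  (forall t x, V x -> f (rs t x) = t * f x) ->
  0 <= c -> (forall x, V x -> f x * f x <= c * B x x) ->
  exists u : nat -> K, (forall n, V (u n)) /\
    (forall eps, 0 < eps -> exists N, forall n m, (N <= n)%nat -> (N <= m)%nat ->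
       B (ksub (u n) (u m)) (ksub (u n) (u m)) < eps) /\
    (forall x, V x -> Un_cv (fun n => B x (u n)) (f x)).
Proof.
  intros V0 VD VZ BC BD BZ Bge fD fZ Hc fb.
  set (q := fun x => B x x - 2 * f x).
  assert (Hlow : forall x, V x -> - c <= q x).
  { intros x Hx. unfold q. specialize (fb x Hx). specialize (Bge x Hx).
    assert (H : Rabs (2 * f x) <= Rabs (B x x + c)).
    { apply Rsqr_le_abs_0. pose proof (Rle_0_sqr (B x x - c)). unfold Rsqr in *. lra. }
    pose proof (Rle_abs (2 * f x)). rewrite (Rabs_pos_eq (B x x + c)) in H by lra. lra. }
  destruct (completeness (fun r => exists x, V x /\ r = - q x)) as [m [Hub Hlub]].
  { exists c. intros r [x [Hx ->]]. specialize (Hlow x Hx). lra. }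
  { exists (- q k0), k0. split; [exact V0 | reflexivity]. }
  assert (Hu : forall n : nat, exists x, V x /\ q x <= - m + / (INR n + 1)).
  { intros n. apply NNPP; intros Hn.
    assert (He : 0 < / (INR n + 1)) by (apply Rinv_0_lt_compat; pose proof (pos_INR n); lra).
    assert (m <= m - / (INR n + 1)); [|lra].
    apply Hlub. intros r [x [Hx ->]].
    destruct (Rle_lt_dec (q x) (- m + / (INR n + 1))); [|lra].
    exfalso. apply Hn. exists x. split; assumption. }
  set (u := fun n => proj1_sig (constructive_indefinite_description _ (Hu n))).
  assert (HuP : forall n, V (u n) /\ q (u n) <= - m + / (INR n + 1)).
  { intros n. exact (proj2_sig (constructive_indefinite_description _ (Hu n))). }
  assert (HuV : forall n, V (u n)) by apply HuP.
  assert (Huq : forall n, q (u n) <= - m + / (INR n + 1)) by apply HuP.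
  clearbody u.
  (* As [- m] is the infimum of [q], moving the near-minimizer [u n] by [t x] yields a quadratic in
     [t] that is nonnegative everywhere; its discriminant gives this bound. *)
  assert (key : forall n x, V x ->
    (B x (u n) - f x) * (B x (u n) - f x) <= B x x * / (INR n + 1)).
  { intros n x Hx. apply nonneg_quadratic_discr. intros t.
    assert (Ht : V (rs t x)) by (apply VZ, Hx).
    assert (Hq : - q (kadd (u n) (rs t x)) <= m).
    { apply Hub. eexists. split; [|reflexivity]. apply VD; auto. }
    assert (HB : B (kadd (u n) (rs t x)) (kadd (u n) (rs t x)) =
      B (u n) (u n) + 2 * t * B x (u n) + t * t * B x x).
    { rewrite BD, (BC (u n)), (BC (rs t x) (kadd _ _)), !BD by auto.
      rewrite (BC (u n) (rs t x)), !BZ, (BC x (rs t x)), BZ by auto. ring. }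
    unfold q in Hq. rewrite HB, fD, fZ in Hq by auto.
    specialize (Huq n). unfold q in Huq. lra. }
  exists u. split; [exact HuV|]. split.
  - intros eps He.
    (* With [B d d = a - b] the bounds on [a] and [b] give [s * s <= 4 * s * (eps / 5)]; a
       denominator above 4 leaves [s < eps] strict. *)
    destruct (eventually_inv_lt (eps / 5)) as [N HN]; [lra|].
    exists N. intros n p Hn Hp. specialize (HN n Hn) as H1. specialize (HN p Hp) as H2.
    set (d := ksub (u n) (u p)).
    assert (Hd : V d) by (unfold d; rewrite ksub_rs; auto).
    assert (Hdd : B d d = (B d (u n) - f d) - (B d (u p) - f d)).
    { transitivity (B (ksub (u n) (u p)) d); [reflexivity|].
      rewrite ksub_rs, BD, BZ, (BC d (u n)), (BC d (u p)) by auto. ring. }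
    pose proof (key n d Hd) as K1. pose proof (key p d Hd) as K2. pose proof (Bge d Hd) as Hge.
    set (a := B d (u n) - f d) in *. set (b := B d (u p) - f d) in *.
    set (s := B d d) in *.
    assert (s * s <= 4 * s * (eps / 5)).
    { apply Rle_trans with (2 * (a * a) + 2 * (b * b)).
      - rewrite Hdd. pose proof (Rle_0_sqr (a + b)). unfold Rsqr in *. lra.
      - apply Rlt_le in H1, H2.
        apply (Rmult_le_compat_l s) in H1, H2; [lra | exact Hge | exact Hge]. }
    nra.
  - intros x Hx eps He.
    destruct (eventually_inv_lt (eps * eps / (B x x + 1))) as [N HN].
    { apply Rdiv_lt_0_compat; [nra|]. specialize (Bge x Hx). lra. }
    exists N. intros n Hn. specialize (HN n Hn). unfold Rdist.
    specialize (key n x Hx). specialize (Bge x Hx).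
    rewrite <- (Rabs_pos_eq eps) by lra. apply Rsqr_lt_abs_0. unfold Rsqr.
    apply Rle_lt_trans with (1 := key).
    apply Rmult_lt_compat_l with (r := B x x + 1) in HN; [|lra].
    replace ((B x x + 1) * (eps * eps / (B x x + 1))) with (eps * eps) in HN by (field; lra).
    assert (0 < / (INR n + 1)) by (apply Rinv_0_lt_compat; pose proof (pos_INR n); lra).
    nra.
Qed.

Lemma ip_small_cauchy (u : nat -> K) :
  (forall eps, 0 < eps -> exists N, forall n m, (N <= n)%nat -> (N <= m)%nat ->
     ip K (ksub (u n) (u m)) (ksub (u n) (u m)) < eps) -> cauchy K u.
Proof.
  intros H eps He. destruct (H (eps * eps)) as [N HN]; [nra|].
  exists N. intros n m Hn Hm. specialize (HN n m Hn Hm).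
  rewrite knormE, <- (sqrt_square eps) by lra.
  apply sqrt_lt_1_alt. split; [apply ip_ge0 | exact HN].
Qed.

Lemma riesz (f : K -> R) (c : R) :
  (forall x y, f (kadd x y) = f x + f y) -> (forall t x, f (rs t x) = t * f x) ->
  (forall x, Rabs (f x) <= c * norm x) ->
  exists z, forall x, f x = rf x z.
Proof.
  intros fD fZ fb.
  destruct (riesz_sequence (fun _ => True) (ip K) f (c * c)) as [u [_ [Hc Hcv]]]; auto.
  - intros; apply ipC.
  - intros; apply ipDl.
  - intros; apply ipsl.
  - intros; apply ip_ge0.
  - nra.
  - intros x _. rewrite <- knorm_sq. specialize (fb x).
    replace (f x * f x) with (Rabs (f x) * Rabs (f x)) by (rewrite <- Rabs_mult; apply Rabs_pos_eq; nra).
    pose proof (Rabs_pos (f x)). nra.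
  - destruct (krein_complete K u (ip_small_cauchy u Hc)) as [l Hl].
    exists (J K l). intros x. rewrite <- ip_rf_J.
    apply UL_sequence with (fun n => ip K x (u n)); [apply Hcv, I | apply Un_cv_ip, Hl].
Qed.

(** Projection onto the closure of [D]: the minimizing sequence tends to some [l] with [p - l]
    orthogonal to [D] for [ip]. Applying [J] makes it orthogonal for [form], where the hypothesis
    forces it to vanish. *)
Lemma dense_of_orthogonal (D : K -> Prop) :
  D k0 -> (forall x y, D x -> D y -> D (kadd x y)) -> (forall t x, D x -> D (rs t x)) ->
  (forall y, (forall x, D x -> rf x y = 0) -> y = k0) ->
  forall x eps, 0 < eps -> exists y, D y /\ kdist K x y < eps.
Proof.
  intros D0 DD DZ Horth p eps He.
  destruct (riesz_sequence D (ip K) (fun x => ip K x p) (ip K p p)) as [u [Hu [Hc Hcv]]]; auto.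
  - intros; apply ipC.
  - intros; apply ipDl.
  - intros; apply ipsl.
  - intros; apply ip_ge0.
  - intros; apply ipDl.
  - intros; apply ipsl.
  - apply ip_ge0.
  - intros x _. rewrite (Rmult_comm (ip K p p)). apply cauchy_schwarz.
  - destruct (krein_complete K u (ip_small_cauchy u Hc)) as [l Hl].
    assert (Hlp : J K (ksub p l) = k0).
    { apply Horth. intros x Hx. rewrite <- ip_rf_J, ipBr.
      rewrite (UL_sequence _ _ _ (Hcv x Hx) (Un_cv_ip u l x Hl)). ring. }
    assert (Hpl : ksub p l = k0).
    { apply ip_eq0. rewrite <- ip_J, Hlp, ip_rf_J. apply rf0l. }
    replace l with p in Hl by (rewrite <- (kadd_sub K p l), Hpl; apply kadd0).
    destruct (Hl eps He) as [N HN]. exists (u N). split; [apply Hu|].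
    unfold kdist. rewrite knormBC. apply HN. lia.
Qed.

Lemma dense_orthogonal (D : K -> Prop) y :
  (forall x eps, 0 < eps -> exists y, D y /\ kdist K x y < eps) ->
  (forall x, D x -> rf x y = 0) -> y = k0.
Proof.
  intros HD Hy. apply rf_nondeg. intros w. rewrite rfC.
  apply NNPP; intros Hn.
  pose proof (Rabs_pos_lt _ Hn) as Hp. pose proof (knorm_ge0 K y) as Hy0.
  destruct (HD w (Rabs (rf w y) / (norm y + 1))) as [x [Hx Hd]].
  { apply Rdiv_lt_0_compat; lra. }
  unfold kdist in Hd. pose proof (rf_le K (ksub w x) y) as H.
  rewrite rfBl, (Hy x Hx), Rminus_0_r in H.
  pose proof (knorm_ge0 K (ksub w x)).
  apply Rmult_lt_compat_r with (r := norm y + 1) in Hd; [|lra].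
  replace (Rabs (rf w y) / (norm y + 1) * (norm y + 1)) with (Rabs (rf w y)) in Hd by (field; lra).
  nra.
Qed.

(* Gliding hump: [s] controls the size of all later steps, so that they cannot
   undo the value reached at the current one. *)
Lemma uniform_boundedness (D : K -> Prop) (G : K -> K) :
  (forall x y, G (kadd x y) = kadd (G x) (G y)) -> (forall t x, G (rs t x) = rs t (G x)) ->
  (forall w, D w -> exists c, forall u, Rabs (rf (G u) w) <= c * norm u) ->
  exists M, forall u w, D w -> norm w <= 1 -> Rabs (rf (G u) w) <= M * norm u.
Proof.
  intros GD GZ Hb. apply NNPP; intros Hnot.
  assert (HM : forall M, exists u w, D w /\ norm w <= 1 /\ M * norm u < Rabs (rf (G u) w)).
  { intros M. apply NNPP; intros Hn. apply Hnot. exists M. intros u w Dw Hw.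
    destruct (Rle_lt_dec (Rabs (rf (G u) w)) (M * norm u)); [assumption|].
    exfalso. apply Hn. exists u, w. auto. }
  assert (GB : forall x y, G (ksub x y) = ksub (G x) (G y)).
  { intros x y. rewrite !ksub_rs, GD, GZ. reflexivity. }
  assert (step : forall a : nat * (K * R), exists b : K * R, 0 < snd (snd a) ->
    0 < snd b /\ snd b <= snd (snd a) / 2 /\ norm (ksub (fst b) (fst (snd a))) <= snd (snd a) /\
    exists w, norm w <= 1 /\ INR (fst a) <= Rabs (rf (G (fst b)) w) /\
      forall y, norm y <= 2 * snd b -> Rabs (rf (G y) w) <= 1).
  { intros [n [x s]]. simpl.
    destruct (Rlt_le_dec 0 s) as [Hs|Hs]; [|exists (x, s); simpl; lra].
    (* Rescaled to length [s], the vector [u] becomes a step [e] whose value against [w] exceeds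
       [2 n], so [x] or [x + e] has value at least [n]. *)
    destruct (HM (2 * INR n / s)) as [u [w [Dw [Hw Hu]]]].
    destruct (Hb w Dw) as [c Hc].
    pose proof (pos_INR n) as Hn.
    assert (Hu0 : 0 < norm u).
    { destruct (Req_dec (norm u) 0) as [H0|H0]; [|pose proof (knorm_ge0 K u); lra].
      exfalso. pose proof (Hc u) as Hcu. rewrite H0 in *. lra. }
    set (e := rs (s / norm u) u).
    assert (Hk : 0 < s / norm u) by (apply Rdiv_lt_0_compat; lra).
    assert (He : norm e = s).
    { unfold e. rewrite knorms, Rabs_pos_eq by lra. field. lra. }
    assert (HGe : 2 * INR n < Rabs (rf (G e) w)).
    { unfold e. rewrite GZ, rfsl, Rabs_mult, (Rabs_pos_eq (s / norm u)) by lra.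
      apply Rmult_lt_compat_l with (r := s / norm u) in Hu; [|lra].
      replace (s / norm u * (2 * INR n / s * norm u)) with (2 * INR n) in Hu by (field; lra).
      exact Hu. }
    (* Halving keeps the sum of all later moves within [2 * s']; the other bound lets such a move
       change the value against this [w] by at most 1. *)
    set (s' := Rmin (s / 2) (/ (2 * (Rabs c + 1)))).
    pose proof (Rabs_pos c) as Hc0.
    assert (Hs'0 : 0 < s').
    { apply Rmin_glb_lt; [lra|]. apply Rinv_0_lt_compat. lra. }
    assert (Hs'1 : s' <= s / 2) by apply Rmin_l.
    assert (Hs'2 : forall y, norm y <= 2 * s' -> Rabs (rf (G y) w) <= 1).
    { intros y Hy. apply Rle_trans with (1 := Hc y).
      assert (s' * (2 * (Rabs c + 1)) <= 1).
      { pose proof (Rmin_r (s / 2) (/ (2 * (Rabs c + 1)))) as Hr. fold s' in Hr.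
        apply (Rmult_le_compat_r (2 * (Rabs c + 1))) in Hr; [|lra].
        rewrite Rinv_l in Hr by lra. exact Hr. }
      pose proof (Rle_abs c). pose proof (knorm_ge0 K y). nra. }
    destruct (Rle_lt_dec (INR n) (Rabs (rf (G x) w))) as [Hx|Hx].
    - exists (x, s'). simpl. intros _. repeat split; auto.
      + replace (ksub x x) with (rs 0 x) by vec_ring. rewrite knorms, Rabs_R0. lra.
      + exists w. auto.
    - exists (kadd x e, s'). simpl. intros _. repeat split; auto.
      + replace (ksub (kadd x e) x) with e by vec_ring. lra.
      + exists w. repeat split; auto. rewrite GD, rfDl.
        pose proof (Rabs_triang (rf (G x) w + rf (G e) w) (- rf (G x) w)) as Ht.
        rewrite Rabs_Ropp in Ht.
        replace (rf (G x) w + rf (G e) w + - rf (G x) w) with (rf (G e) w) in Ht by ring.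
        lra. }
  set (g := fun a => proj1_sig (constructive_indefinite_description _ (step a))).
  set (st := fix st n := match n with O => (k0, 1) | S k => g (k, st k) end).
  assert (Hg : forall n, 0 < snd (st n) ->
    0 < snd (st (S n)) /\ snd (st (S n)) <= snd (st n) / 2 /\
    norm (ksub (fst (st (S n))) (fst (st n))) <= snd (st n) /\
    exists w, norm w <= 1 /\ INR n <= Rabs (rf (G (fst (st (S n)))) w) /\
      forall y, norm y <= 2 * snd (st (S n)) -> Rabs (rf (G y) w) <= 1).
  { intros n. change (st (S n)) with (g (n, st n)). unfold g.
    destruct (constructive_indefinite_description _ (step (n, st n))) as [b Hb']. exact Hb'. }
  assert (Hpos : forall n, 0 < snd (st n)).
  { induction n as [|n IH]; [simpl; lra | apply (Hg n IH)]. }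
  (* Halving gives [s_n <= 2 (s_n - s_(n+1))], a form of the step bound that telescopes. *)
  assert (Hdist : forall n k,
    norm (ksub (fst (st (n + k)%nat)) (fst (st n))) <= 2 * (snd (st n) - snd (st (n + k)%nat))).
  { intros n k. induction k as [|k IH].
    - rewrite Nat.add_0_r. replace (ksub (fst (st n)) (fst (st n))) with (rs 0 (fst (st n))) by vec_ring.
      rewrite knorms, Rabs_R0. lra.
    - rewrite Nat.add_succ_r. destruct (Hg _ (Hpos (n + k)%nat)) as [_ [Hh [Hd _]]].
      pose proof (knorm_triangle K (fst (st (S (n + k)))) (fst (st (n + k)%nat)) (fst (st n))).
      lra. }
  assert (Hs : forall n, snd (st n) <= / (INR n + 1)).
  { induction n as [|n IH]; [simpl; lra|].
    destruct (Hg n (Hpos n)) as [_ [Hh _]]. rewrite S_INR. pose proof (pos_INR n).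
    apply Rle_trans with (1 := Hh).
    apply Rle_trans with (/ (INR n + 1) / 2); [lra|].
    unfold Rdiv. rewrite <- Rinv_mult. apply Rinv_le_contravar; lra. }
  destruct (krein_complete K (fun n => fst (st n))) as [l Hl].
  { intros eps He. destruct (eventually_inv_lt (eps / 4)) as [N HN]; [lra|].
    exists N. intros n m Hn Hm. specialize (HN N (le_n N)). specialize (Hs N).
    pose proof (Hdist N (n - N)%nat) as H1. pose proof (Hdist N (m - N)%nat) as H2.
    replace (N + (n - N))%nat with n in H1 by lia. replace (N + (m - N))%nat with m in H2 by lia.
    pose proof (Hpos n). pose proof (Hpos m).
    pose proof (knorm_triangle K (fst (st n)) (fst (st N)) (fst (st m))).
    rewrite (knormBC K (fst (st N)) (fst (st m))) in *. lra. }
  assert (Hln : forall n, norm (ksub l (fst (st n))) <= 2 * snd (st n)).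
  { intros n. apply Rnot_lt_le. intros Hlt.
    destruct (Hl (norm (ksub l (fst (st n))) - 2 * snd (st n))) as [N HN]; [lra|].
    specialize (HN (n + N)%nat ltac:(lia)). unfold kdist in HN.
    pose proof (Hdist n N). pose proof (Hpos (n + N)%nat).
    pose proof (knorm_triangle K l (fst (st (n + N)%nat)) (fst (st n))).
    rewrite (knormBC K l (fst (st (n + N)%nat))) in *. lra. }
  (* The value at stage [S n] is at least [n], but passing to [l] changes it by at most 1 and the
     value at [l] is at most [norm (G l)]. *)
  destruct (INR_unbounded (norm (G l) + 1)) as [n Hn].
  destruct (Hg n (Hpos n)) as [_ [_ [_ [w [Hw [Hnw Hsmall]]]]]].
  specialize (Hsmall (ksub (fst (st (S n))) l)).
  rewrite knormBC in Hsmall. specialize (Hsmall (Hln (S n))). rewrite GB, rfBl in Hsmall.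
  pose proof (rf_le K (G l) w). pose proof (knorm_ge0 K (G l)).
  pose proof (Rabs_triang (rf (G (fst (st (S n)))) w - rf (G l) w) (rf (G l) w)) as Ht.
  replace (rf (G (fst (st (S n)))) w - rf (G l) w + rf (G l) w)
    with (rf (G (fst (st (S n)))) w) in Ht by ring.
  nra.
Qed.

Lemma weakly_bounded_bounded (D : K -> Prop) (G : K -> K) :
  (forall x eps, 0 < eps -> exists y, D y /\ kdist K x y < eps) ->
  (forall x y, G (kadd x y) = kadd (G x) (G y)) -> (forall t x, G (rs t x) = rs t (G x)) ->
  (forall w, D w -> exists c, forall u, Rabs (rf (G u) w) <= c * norm u) ->
  exists M, forall u, norm (G u) <= M * norm u.
Proof.
  intros HD GD GZ Hb.
  destruct (uniform_boundedness D G GD GZ Hb) as [M HM].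
  (* The test vector [v] has length 1/2, so an approximation [w] in [D] within 1/4 stays in the unit
     ball; pairing with [G u] gives at least [r / 2 - r / 4]. *)
  exists (4 * M). intros u.
  pose proof (knorm_ge0 K (G u)) as H0. set (r := norm (G u)) in *.
  destruct (Req_dec r 0) as [Hr|Hr].
  (* [M] carries no sign condition, so [0 <= M * norm u] has to be extracted from some test vector
     of [D]. *)
  { destruct (HD k0 1) as [w [Dw Hw]]; [lra|]. unfold kdist in Hw.
    replace (ksub k0 w) with (rs (-1) w) in Hw by vec_ring.
    rewrite knorms, Rabs_left in Hw by lra.
    specialize (HM u w Dw ltac:(lra)). pose proof (Rabs_pos (rf (G u) w)). lra. }
  set (v := rs (/ (2 * r)) (J K (G u))).
  assert (Hk : 0 < / (2 * r)) by (apply Rinv_0_lt_compat; lra).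
  assert (Hv : norm v = / 2).
  { unfold v. rewrite knorms, knorm_J, Rabs_pos_eq by lra. fold r. field. lra. }
  destruct (HD v (/ 4)) as [w [Dw Hw]]; [lra|]. unfold kdist in Hw.
  assert (Hw1 : norm w <= 1).
  { replace w with (kadd v (ksub w v)) by vec_ring.
    pose proof (knormD K v (ksub w v)). rewrite (knormBC K w v) in *. lra. }
  specialize (HM u w Dw Hw1).
  assert (Hrv : rf (G u) v = r / 2).
  { unfold v. rewrite rfsr, <- ip_rf_J, <- knorm_sq. fold r. field. lra. }
  pose proof (rf_le K (G u) (ksub v w)) as H1. rewrite rfBr, Hrv in H1. fold r in H1.
  pose proof (Rle_abs (rf (G u) w)). pose proof (Rle_abs (r / 2 - rf (G u) w)).
  nra.
Qed.

End Analysis.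

(** * Krein space adjoints and the double adjoint *)

Section Adjoints.
Variable K : KreinSpace.
Implicit Types x y z w v : K.
Implicit Types S T : Op K.

Local Notation norm := (knorm K).

Lemma formDr x y z : form z (kadd x y) = Cadd (form z x) (form z y).
Proof.
  rewrite (form_herm K (kadd x y)), formDl, (form_herm K x z), (form_herm K y z).
  unfold Cconj, Cadd. simpl. f_equal; ring.
Qed.

Lemma formZr a x z : form z (kscal a x) = Cmul (Cconj a) (form z x).
Proof.
  rewrite (form_herm K (kscal a x)), formZl, (form_herm K x z).
  unfold Cconj, Cmul. simpl. f_equal; ring.
Qed.

(** Testing with [i x] as well as [x] recovers the imaginary part. *)
Lemma adj_rel_re T y z : linear_op T ->
  (forall x, dom T x -> rf (app T x) y = rf x z) -> adj_rel T y z.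
Proof.
  intros [_ [_ HZ]] H x Hx. destruct (HZ (Cmk 0 1) x Hx) as [Hix Eix].
  pose proof (H x Hx) as H1. pose proof (H _ Hix) as H2.
  rewrite Eix, !rfZl in H2. simpl in H2. unfold rf, imf in *.
  destruct (form (app T x) y), (form x z). simpl in *. f_equal; lra.
Qed.

Lemma rf_adj T y z x : adj_rel T y z -> dom T x -> rf (app T x) y = rf x z.
Proof. intros H Hx. unfold rf. rewrite (H x Hx). reflexivity. Qed.

(** Comparing graphs avoids the [epsilon] inside [adj] and lets [T] and its adjoint exchange roles.
    As [S] is single valued, density of [dom T] is already encoded for linear [T]. *)
Definition is_adjoint T S : Prop :=
  forall y z, adj_rel T y z <-> dom S y /\ app S y = z.

Lemma is_adjoint_linear T S : is_adjoint T S -> linear_op S.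
Proof.
  intros H.
  assert (HS : forall y, dom S y -> adj_rel T y (app S y)) by (intros y Hy; apply H; auto).
  assert (Fr0 : forall a, form a (@k0 K) = C0).
  { intros a. pose proof (rf0r K a) as H1. pose proof (imfC K a k0) as H2.
    rewrite imf0l in H2. unfold rf, imf in *. destruct (form a k0). simpl in *.
    unfold C0. f_equal; lra. }
  split; [|split].
  - apply (H k0 k0). intros x _. rewrite !Fr0. reflexivity.
  - intros x y Hx Hy. apply H. intros u Hu.
    rewrite !formDr, (HS x Hx u Hu), (HS y Hy u Hu). reflexivity.
  - intros a x Hx. apply H. intros u Hu.
    rewrite !formZr, (HS x Hx u Hu). reflexivity.
Qed.

(** A vector [y] orthogonal to [dom T] is related to [k0] by the adjoint relation, hence
    [y = S k0 = k0]. *)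
Lemma is_adjoint_dense T S : linear_op T -> is_adjoint T S ->
  densely_defined T.
Proof.
  intros HT H. destruct (HT) as [H0 [HD HZ]].
  destruct (is_adjoint_linear T S H) as [S0 [_ SZ]].
  unfold densely_defined. apply dense_of_orthogonal; auto.
  - intros x y Hx Hy. apply HD; assumption.
  - intros t x Hx. apply HZ, Hx.
  - intros y Hy.
    assert (Hr : adj_rel T k0 y).
    { apply adj_rel_re; [exact HT|]. intros x Hx. rewrite rf0r, (Hy x Hx). reflexivity. }
    apply H in Hr. destruct Hr as [_ <-].
    destruct (SZ C0 k0 S0) as [_ E]. rewrite !kscal0 in E. exact E.
Qed.

Lemma adj_is_adjoint T : densely_defined T -> is_adjoint T (adj T).
Proof.
  intros HT.
  assert (Huniq : forall y z z', adj_rel T y z -> adj_rel T y z' -> z = z').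
  { intros y z z' Hz Hz'.
    assert (H : ksub z z' = k0).
    { apply dense_orthogonal with (dom T); [exact HT|]. intros x Hx.
      rewrite rfBr, <- (rf_adj T y z x Hz Hx), <- (rf_adj T y z' x Hz' Hx). ring. }
    rewrite <- (kadd_sub K z z'), H. apply kadd0. }
  intros y z. split.
  - intros Hz. split; [exists z; exact Hz|].
    apply (Huniq y); [|exact Hz]. exact (epsilon_spec (inhabits k0) (adj_rel T y) (ex_intro _ z Hz)).
  - intros [Hy <-]. exact (epsilon_spec (inhabits k0) (adj_rel T y) Hy).
Qed.

Lemma is_adjoint_symm_rel T S y z : is_adjoint T S -> dom T y -> app T y = z -> adj_rel S y z.
Proof.
  intros H Hy <- w Hw.
  assert (Hr : adj_rel T w (app S w)) by (apply H; auto).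
  specialize (Hr y Hy).
  rewrite (form_herm K y (app S w)), <- Hr, <- form_herm. reflexivity.
Qed.

(* The point of the graph of [T] closest to [(x0, y0)] differs from it by an element
   orthogonal to the graph, that is, up to [J], by an element of the graph of [S]. *)
Lemma double_adjoint T S :
  linear_op T -> closed_op T -> is_adjoint T S -> is_adjoint S T.
Proof.
  intros HT Hcl H. split; [|intros [Hy E]; apply is_adjoint_symm_rel with T; auto].
  rename y into x0, z into y0.
  intros Hxy. destruct (HT) as [T0 [TD TZ]].
  assert (TB : forall x y, dom T x -> dom T y ->
    dom T (ksub x y) /\ app T (ksub x y) = ksub (app T x) (app T y)).
  { intros x y Hx Hy. rewrite !ksub_rs. destruct (TZ (Cmk (-1) 0) y Hy) as [Hd E].
    destruct (TD x _ Hx Hd) as [Hd' E']. split; [exact Hd'|].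
    unfold rs. rewrite E', E. reflexivity. }
  (* This is the graph inner product, so a Cauchy sequence for it has a limit in the graph by
     closedness. The factor 2 comes from [(p + q)^2 <= 2 p^2 + 2 q^2]. *)
  destruct (riesz_sequence K (dom T)
    (fun x y => ip K x y + ip K (app T x) (app T y))
    (fun x => ip K x x0 + ip K (app T x) y0)
    (2 * (ip K x0 x0 + ip K y0 y0))) as [u [Hu [Hc Hcv]]].
  - exact T0.
  - intros x y Hx Hy. apply TD; assumption.
  - intros t x Hx. apply TZ, Hx.
  - intros x y _ _. rewrite (ipC K x y), (ipC K (app T x)). reflexivity.
  - intros x y z Hx Hy _. rewrite (proj2 (TD x y Hx Hy)), !ipDl. ring.
  - intros t x z Hx _. unfold rs. rewrite (proj2 (TZ _ x Hx)).
    fold (rs t x) (rs t (app T x)). rewrite !ipsl. ring.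
  - intros x _. pose proof (ip_ge0 K x). pose proof (ip_ge0 K (app T x)). lra.
  - intros x y Hx Hy. rewrite (proj2 (TD x y Hx Hy)), !ipDl. ring.
  - intros t x Hx. unfold rs. rewrite (proj2 (TZ _ x Hx)).
    fold (rs t x) (rs t (app T x)). rewrite !ipsl. ring.
  - pose proof (ip_ge0 K x0). pose proof (ip_ge0 K y0). lra.
  - intros x _.
    pose proof (cauchy_schwarz K x x0). pose proof (cauchy_schwarz K (app T x) y0).
    pose proof (ip_ge0 K x0). pose proof (ip_ge0 K y0).
    pose proof (ip_ge0 K x). pose proof (ip_ge0 K (app T x)).
    pose proof (Rle_0_sqr (ip K x x0 - ip K (app T x) y0)) as Hs. unfold Rsqr in Hs.
    assert (0 <= ip K x x * ip K y0 y0) by (apply Rmult_le_pos; assumption).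
    assert (0 <= ip K (app T x) (app T x) * ip K x0 x0) by (apply Rmult_le_pos; assumption).
    lra.
  - destruct (krein_complete K u) as [a Ha].
    { apply ip_small_cauchy. intros eps He. destruct (Hc eps He) as [N HN].
      exists N. intros n m Hn Hm. specialize (HN n m Hn Hm). simpl in HN.
      pose proof (ip_ge0 K (app T (ksub (u n) (u m)))). lra. }
    destruct (krein_complete K (fun n => app T (u n))) as [b Hb].
    { apply ip_small_cauchy. intros eps He. destruct (Hc eps He) as [N HN].
      exists N. intros n m Hn Hm. specialize (HN n m Hn Hm). simpl in HN.
      rewrite (proj2 (TB _ _ (Hu n) (Hu m))) in HN.
      pose proof (ip_ge0 K (ksub (u n) (u m))). lra. }
    destruct (Hcl u a b Hu Ha Hb) as [Hda Eab].
    assert (Horth : forall x, dom T x -> ip K x (ksub x0 a) + ip K (app T x) (ksub y0 b) = 0).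
    { intros x Hx. rewrite !ipBr.
      pose proof (UL_sequence _ _ _ (Hcv x Hx)
        (CV_plus _ _ _ _ (Un_cv_ip K u a x Ha)
           (Un_cv_ip K (fun n => app T (u n)) b (app T x) Hb))) as E.
      lra. }
    assert (Hadj : adj_rel T (J K (ksub y0 b)) (rs (-1) (J K (ksub x0 a)))).
    { apply adj_rel_re; [exact HT|]. intros x Hx.
      rewrite rfsr, <- !ip_rf_J. specialize (Horth x Hx). lra. }
    apply H in Hadj. destruct Hadj as [Hdw Ew].
    pose proof (rf_adj S x0 y0 _ Hxy Hdw) as E0.
    assert (Hab : adj_rel S a b) by (apply is_adjoint_symm_rel with T; assumption).
    pose proof (rf_adj S a b _ Hab Hdw) as E1.
    rewrite Ew, rfsl in E0, E1.
    (* Both [(x0, y0)] and [(a, b)] satisfy the adjoint relation of [S]; subtracting their pairings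
       with the orthogonal vector leaves the squared distance. *)
    assert (E : ip K (ksub x0 a) (ksub x0 a) + ip K (ksub y0 b) (ksub y0 b) = 0).
    { rewrite !ip_rf_J, rfC, (rfC K (ksub y0 b)), !rfBr. lra. }
    pose proof (ip_ge0 K (ksub x0 a)). pose proof (ip_ge0 K (ksub y0 b)).
    assert (Ex : ksub x0 a = k0) by (apply ip_eq0; lra).
    assert (Ey : ksub y0 b = k0) by (apply ip_eq0; lra).
    rewrite <- (kadd_sub K x0 a), <- (kadd_sub K y0 b), Ex, Ey, !kadd0. auto.
Qed.

(** * Resolvents of the two products and selfadjointness *)

Definition dual_pair T S : Prop := is_adjoint T S /\ is_adjoint S T.

Lemma dual_pair_sym T S : dual_pair T S -> dual_pair S T.
Proof. intros [H1 H2]. split; assumption. Qed.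

Lemma rf_dual T S x y : dual_pair T S -> dom T x -> dom S y ->
  rf (app T x) y = rf x (app S y).
Proof. intros [H _] Hx Hy. apply rf_adj; [apply H; auto | exact Hx]. Qed.

Definition resolvent_of T S (lam : Defs.C) (R : K -> K) : Prop :=
  (forall u, dom (op_comp S T) (R u) /\
     ksub (app S (app T (R u))) (kscal lam (R u)) = u) /\
  (forall x, dom (op_comp S T) x -> R (ksub (app S (app T x)) (kscal lam x)) = x) /\
  (exists M, 0 <= M /\ forall u, norm (R u) <= M * norm u /\ norm (app T (R u)) <= M * norm u).

Lemma op_comp_linear T S : linear_op T -> linear_op S -> linear_op (op_comp S T).
Proof.
  intros [T0 [TD TZ]] [S0 [SD SZ]]. split; [|split]; simpl.
  - split; [exact T0|].
    destruct (TZ C0 k0 T0) as [_ E]. rewrite !kscal0 in E. rewrite E. exact S0.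
  - intros x y [Hx Hx'] [Hy Hy'].
    destruct (TD x y Hx Hy) as [H1 E1]. rewrite E1.
    destruct (SD _ _ Hx' Hy') as [H2 E2]. auto.
  - intros a x [Hx Hx'].
    destruct (TZ a x Hx) as [H1 E1]. rewrite E1.
    destruct (SZ a _ Hx') as [H2 E2]. auto.
Qed.

(** For [w] in the dense set [dom S], [[T R u, w] = [R u, S w]] is bounded in [u] because [R] is;
    hence [T R] is weakly bounded, and so bounded. *)
Lemma resolvent_exists T S lam : dual_pair T S ->
  in_resolvent (op_comp S T) lam -> exists R, resolvent_of T S lam R.
Proof.
  intros HP [Hinj [Hsur [c Hc]]]. destruct (HP) as [HTS HST].
  pose proof (is_adjoint_linear _ _ HTS) as LS. pose proof (is_adjoint_linear _ _ HST) as LT.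
  destruct (op_comp_linear T S LT LS) as [_ [AD AZ]].
  destruct (LT) as [_ [TD TZ]].
  set (R := fun u => proj1_sig (constructive_indefinite_description _ (Hsur u))).
  assert (HR : forall u, dom (op_comp S T) (R u) /\
     ksub (app (op_comp S T) (R u)) (kscal lam (R u)) = u).
  { intros u. exact (proj2_sig (constructive_indefinite_description _ (Hsur u))). }
  clearbody R.
  assert (HL : forall x u, dom (op_comp S T) x ->
     ksub (app (op_comp S T) x) (kscal lam x) = u -> R u = x).
  { intros x u Hx E. apply Hinj; [apply HR | exact Hx|]. rewrite E. apply HR. }
  assert (RD : forall x y, R (kadd x y) = kadd (R x) (R y)).
  { intros x y. destruct (HR x) as [Dx Ex]. destruct (HR y) as [Dy Ey].
    destruct (AD _ _ Dx Dy) as [D E]. apply HL; [exact D|]. rewrite E.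
    rewrite <- Ex at 3. rewrite <- Ey at 3. vec_ring. }
  assert (RZ : forall t x, R (rs t x) = rs t (R x)).
  { intros t x. destruct (HR x) as [Dx Ex]. destruct (AZ (Cmk t 0) _ Dx) as [D E].
    apply HL; [exact D|]. unfold rs. rewrite E. rewrite <- Ex at 3. vec_ring. }
  assert (HRb : forall u, norm (R u) <= Rabs c * norm u).
  { intros u. destruct (HR u) as [D E]. specialize (Hc _ D). rewrite E in Hc.
    pose proof (Rle_abs c). pose proof (knorm_ge0 K u). nra. }
  destruct (weakly_bounded_bounded K (dom S) (fun u => app T (R u))) as [M HM].
  - apply is_adjoint_dense with T; assumption.
  - intros x y. rewrite RD. apply TD; apply HR.
  - intros t x. rewrite RZ. apply TZ, HR.
  - intros w Hw. exists (Rabs c * norm (app S w)). intros u.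
    rewrite (rf_dual T S) by (auto; apply HR).
    apply Rle_trans with (1 := rf_le K _ _).
    pose proof (HRb u). pose proof (knorm_ge0 K (app S w)). nra.
  - exists R. split; [exact HR|]. split; [intros x Hx; apply HL; auto|].
    exists (Rabs c + Rabs M). pose proof (Rabs_pos c). pose proof (Rabs_pos M).
    split; [lra|]. intros u. pose proof (HRb u). pose proof (HM u).
    pose proof (Rle_abs M). pose proof (knorm_ge0 K u). split; nra.
Qed.

(* From (A - lam) x = S v with A = S T one gets (T S - lam) (T x - v) = lam v, so that the
   solution v of (T S - mu) v = u is corrected to one of (T S - lam) y = u. *)
Lemma resolvent_transfer T S lam mu : dual_pair T S -> lam <> C0 ->
  in_resolvent (op_comp S T) lam -> in_resolvent (op_comp T S) mu ->
  in_resolvent (op_comp T S) lam.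
Proof.
  intros HP Hlam HA HB.
  destruct (resolvent_exists T S lam HP HA) as [R [HR [HRl [M [HM0 HM]]]]].
  destruct (resolvent_exists S T mu (dual_pair_sym _ _ HP) HB) as [Q [HQ [HQl [M' [HM'0 HM']]]]].
  destruct HA as [Hinj _].
  destruct HP as [HTS HST].
  pose proof (is_adjoint_linear _ _ HTS) as LS. pose proof (is_adjoint_linear _ _ HST) as LT.
  destruct (op_comp_linear S T LS LT) as [_ [BD BZ]].
  destruct (op_comp_linear T S LT LS) as [A0 [_ AZ]].
  destruct (LT) as [T0 [TD TZ]]. destruct (LS) as [S0 [SD SZ]].
  assert (Ek : forall X : Op K, linear_op X -> app X k0 = k0).
  { intros X [X0 [_ XZ]]. destruct (XZ C0 k0 X0) as [_ E]. rewrite !kscal0 in E. exact E. }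
  assert (Hn : re lam * re lam + im lam * im lam <> 0).
  { intros E. apply Hlam. destruct lam as [p q]. simpl in E. unfold C0. f_equal; nra. }
  (* If [T S w = lam w], then [S w] lies in the kernel of [S T - lam], so [S w = 0] and [lam w = 0];
     dividing by [lam] finishes. *)
  assert (inj0 : forall w, dom (op_comp T S) w ->
    ksub (app T (app S w)) (kscal lam w) = k0 -> w = k0).
  { intros w [Hw Hw'] E.
    assert (E' : app T (app S w) = kscal lam w).
    { rewrite <- (kadd_sub K (app T (app S w)) (kscal lam w)), E. apply kadd0. }
    destruct (SZ lam w Hw) as [Dl El].
    assert (ES : app S w = k0).
    { apply Hinj; [split; [exact Hw' | rewrite E'; exact Dl] | exact A0 |].
      simpl. rewrite E', El, (Ek T LT), (Ek S LS). vec_ring. }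
    rewrite ES, (Ek T LT) in E'.
    transitivity (kscal (Cmk (re lam / (re lam * re lam + im lam * im lam))
                     (- im lam / (re lam * re lam + im lam * im lam))) (kscal lam w)).
    - apply rf_ext. intros v. autorewrite with form_left. simpl. field. exact Hn.
    - rewrite <- E'. vec_ring. }
  (* [c = (lam - mu) / lam], chosen so that the correction contributes [c lam v = (lam - mu) v],
     which turns [(T S - lam) v] into [(T S - mu) v]. *)
  set (c := Cmul (Cadd lam (Cmul (Cmk (-1) 0) mu))
              (Cmk (re lam / (re lam * re lam + im lam * im lam))
                     (- im lam / (re lam * re lam + im lam * im lam)))).
  assert (Hmu : mu = Cadd lam (Cmul (Cmk (-1) 0) (Cmul c lam))).
  { unfold c, Cmul, Cadd. destruct lam as [p q], mu as [r s]. simpl in *.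
    f_equal; field; exact Hn. }
  clearbody c.
  set (X := fun u => kadd (Q u) (kscal c (ksub (app T (R (app S (Q u)))) (Q u)))).
  assert (HX : forall u, dom (op_comp T S) (X u) /\
     ksub (app T (app S (X u))) (kscal lam (X u)) = u).
  { intros u. destruct (HQ u) as [[D1 D2] E]. unfold X.
    set (v := Q u) in *.
    destruct (HR (app S v)) as [[D3 D4] E']. set (x := R (app S v)) in *.
    assert (ESTx : app S (app T x) = kadd (app S v) (kscal lam x)).
    { rewrite <- E'. vec_ring. }
    assert (Dx : dom T (kscal lam x) /\ app T (kscal lam x) = kscal lam (app T x))
      by (apply TZ, D3).
    destruct (TD (app S v) (kscal lam x) D2 (proj1 Dx)) as [D5 E5].
    assert (DTx : dom (op_comp T S) (app T x)).
    { split; [exact D4 | rewrite ESTx; exact D5]. }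
    assert (ETx : app T (app S (app T x)) = kadd (app T (app S v)) (kscal lam (app T x))).
    { rewrite ESTx, E5, (proj2 Dx). reflexivity. }
    assert (Dv : dom (op_comp T S) v) by (split; assumption).
    destruct (BZ (Cmk (-1) 0) v Dv) as [D6 E6].
    destruct (BD _ _ DTx D6) as [D7 E7].
    destruct (BZ c _ D7) as [D8 E8].
    destruct (BD _ _ Dv D8) as [D9 E9].
    rewrite !ksub_rs with (y := v). unfold rs.
    split; [exact D9|]. simpl in E6, E7, E8, E9. rewrite E9, E8, E7, E6, ETx.
    rewrite <- E. rewrite Hmu. apply rf_ext. intros w. autorewrite with form_left.
    simpl. ring. }
  split; [|split].
  - intros x y Hx Hy E. simpl in E.
    destruct (BZ (Cmk (-1) 0) y Hy) as [D6 E6].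
    destruct (BD _ _ Hx D6) as [D7 E7]. simpl in E6, E7.
    assert (H0 : kadd x (kscal (Cmk (-1) 0) y) = k0).
    { apply inj0; [exact D7|]. rewrite E7, E6.
      transitivity (ksub (ksub (app T (app S x)) (kscal lam x))
        (ksub (app T (app S y)) (kscal lam y))); [vec_ring | rewrite E; vec_ring]. }
    replace x with (kadd (kadd x (kscal (Cmk (-1) 0) y)) y) by vec_ring.
    rewrite H0. vec_ring.
  - intros u. exists (X u). exact (HX u).
  - exists (M' + sqrt (re c * re c + im c * im c) * (M * M' + M')).
    intros x Hx. simpl. remember (ksub (app T (app S x)) (kscal lam x)) as u eqn:Hu.
    assert (Ex : x = X u).
    { destruct (HX u) as [D E].
      destruct (BZ (Cmk (-1) 0) x Hx) as [D6 E6].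
      destruct (BD _ _ D D6) as [D7 E7]. simpl in E6, E7.
      assert (H0 : kadd (X u) (kscal (Cmk (-1) 0) x) = k0).
      { apply inj0; [exact D7|]. rewrite E7, E6.
        transitivity (ksub (ksub (app T (app S (X u))) (kscal lam (X u)))
                        (ksub (app T (app S x)) (kscal lam x)));
          [vec_ring | rewrite E, <- Hu; vec_ring]. }
      transitivity (ksub (X u) (kadd (X u) (kscal (Cmk (-1) 0) x))); [vec_ring|].
      rewrite H0. vec_ring. }
    rewrite Ex at 1. unfold X.
    destruct (HM' u) as [N1 N2]. destruct (HM (app S (Q u))) as [_ N3].
    apply Rle_trans with (1 := knormD K _ _). rewrite knormZ.
    pose proof (sqrt_pos (re c * re c + im c * im c)) as Hsq.
    set (sq := sqrt (re c * re c + im c * im c)) in *.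
    assert (N4 : norm (ksub (app T (R (app S (Q u)))) (Q u)) <= (M * M' + M') * norm u).
    { rewrite ksub_rs. apply Rle_trans with (1 := knormD K _ _).
      rewrite knorms, Rabs_left by lra. nra. }
    apply (Rmult_le_compat_l sq) in N4; [|exact Hsq]. lra.
Qed.

Lemma in_resolvent_selfadjoint T S lam : dual_pair T S ->
  in_resolvent (op_comp S T) lam -> in_resolvent (op_comp T S) lam ->
  selfadjoint (op_comp S T).
Proof.
  intros HP HA HB.
  destruct (resolvent_exists T S lam HP HA) as [R [HR [HRl [M [HM0 HM]]]]].
  destruct (resolvent_exists S T lam (dual_pair_sym _ _ HP) HB) as [Q [HQ [HQl [M' [HM'0 HM']]]]].
  pose proof (dual_pair_sym _ _ HP) as HP'.
  destruct HP as [HTS HST].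
  pose proof (is_adjoint_linear _ _ HTS) as LS. pose proof (is_adjoint_linear _ _ HST) as LT.
  pose proof (conj HTS HST : dual_pair T S) as HP.
  pose proof (op_comp_linear T S LT LS) as LA. destruct (LA) as [A0 [AD AZ]].
  pose proof (op_comp_linear S T LS LT) as LB. destruct (LB) as [B0 [BD BZ]].
  destruct (LT) as [T0 [TD TZ]]. destruct (LS) as [S0 [SD SZ]].
  assert (RD : forall x y, R (kadd x y) = kadd (R x) (R y)).
  { intros x y. destruct (HR x) as [Dx Ex]. destruct (HR y) as [Dy Ey].
    destruct (AD _ _ Dx Dy) as [D E]. rewrite <- (HRl _ D). f_equal. simpl in E. rewrite E.
    rewrite <- Ex at 1. rewrite <- Ey at 1. vec_ring. }
  assert (RZ : forall a x, R (kscal a x) = kscal a (R x)).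
  { intros a x. destruct (HR x) as [Dx Ex]. destruct (AZ a _ Dx) as [D E].
    rewrite <- (HRl _ D). f_equal. simpl in E. rewrite E.
    rewrite <- Ex at 1. vec_ring. }
  assert (QD : forall x y, Q (kadd x y) = kadd (Q x) (Q y)).
  { intros x y. destruct (HQ x) as [Dx Ex]. destruct (HQ y) as [Dy Ey].
    destruct (BD _ _ Dx Dy) as [D E]. rewrite <- (HQl _ D). f_equal. simpl in E. rewrite E.
    rewrite <- Ex at 1. rewrite <- Ey at 1. vec_ring. }
  assert (QZ : forall t x, Q (rs t x) = rs t (Q x)).
  { intros t x. destruct (HQ x) as [Dx Ex]. destruct (BZ (Cmk t 0) _ Dx) as [D E].
    unfold rs. rewrite <- (HQl _ D). f_equal. simpl in E. rewrite E.
    rewrite <- Ex at 1. vec_ring. }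
  (* [S T - lam] sends [S (Q w)] to [S ((T S - lam) (Q w)) = S w]; the domains fit because
     [T S (Q w) = w + lam Q w]. *)
  assert (RS : forall w, dom S w -> R (app S w) = app S (Q w)).
  { intros w Hw. destruct (HQ w) as [[D1 D2] E].
    assert (ET : app T (app S (Q w)) = kadd w (kscal lam (Q w))) by (rewrite <- E at 2; vec_ring).
    destruct (SZ lam _ D1) as [D3 E3]. destruct (SD _ _ Hw D3) as [D4 E4].
    rewrite <- (HRl (app S (Q w))).
    - f_equal. rewrite ET, E4, E3. vec_ring.
    - split; [exact D2 | rewrite ET; exact D4]. }
  (* The mirrored computation gives [Q (T x) = T (R x)], and [S T (R x)] is read off the resolvent
     equation. *)
  assert (QT : forall x, dom T x -> app S (Q (app T x)) = kadd x (kscal lam (R x))).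
  { intros x Hx. destruct (HR x) as [[D1 D2] E].
    assert (ES : app S (app T (R x)) = kadd x (kscal lam (R x))) by (rewrite <- E at 2; vec_ring).
    destruct (TZ lam _ D1) as [D3 E3]. destruct (TD _ _ Hx D3) as [D4 E4].
    rewrite <- ES. f_equal. rewrite <- (HQl (app T (R x))).
    - f_equal. rewrite ES, E4, E3. vec_ring.
    - split; [exact D2 | rewrite ES; exact D4]. }
  assert (adjR : forall v, exists z, dom (op_comp S T) z /\
    ksub (app S (app T z)) (kscal (Cconj lam) z) = v /\ forall u, rf (R u) v = rf u z).
  { intros v.
    destruct (riesz K (fun u => rf (R u) v) (M * norm v)) as [z Hz].
    { intros x y. rewrite RD, rfDl. reflexivity. }
    { intros t x. unfold rs. rewrite RZ. apply rfsl. }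
    { intros x. apply Rle_trans with (1 := rf_le K _ _).
      destruct (HM x) as [N _]. pose proof (knorm_ge0 K v). nra. }
    (* Here [z = R^+ v] and [t = (S Q)^+ v]; the relation [RS] identifies [t] with [T z], and [QT]
       then computes [S t]. *)
    destruct (riesz K (fun w => rf (app S (Q w)) v) (M' * norm v)) as [t Ht].
    { intros x y. rewrite QD, (proj2 (SD _ _ (proj1 (proj1 (HQ x))) (proj1 (proj1 (HQ y))))), rfDl.
      reflexivity. }
    { intros s x. rewrite QZ. unfold rs. rewrite (proj2 (SZ _ _ (proj1 (proj1 (HQ x))))).
      fold (rs s (app S (Q x))). apply rfsl. }
    { intros x. apply Rle_trans with (1 := rf_le K _ _).
      destruct (HM' x) as [_ N]. pose proof (knorm_ge0 K v). nra. }
    assert (H1 : adj_rel S z t).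
    { apply adj_rel_re; [exact LS|]. intros w Hw. rewrite <- Hz, <- Ht, RS; auto. }
    apply HST in H1. destruct H1 as [Dz Ez].
    assert (H2 : adj_rel T t (kadd v (kscal (Cconj lam) z))).
    { apply adj_rel_re; [exact LT|]. intros x Hx.
      rewrite <- Ht, (QT x Hx), rfDl, rfDr, <- (rf_conj K lam x z), <- Hz, RZ.
      reflexivity. }
    apply HTS in H2. destruct H2 as [Dt Et].
    exists z. split; [split; [exact Dz | rewrite Ez; exact Dt]|]. split; [|exact Hz].
    rewrite Ez, Et. vec_ring. }
  assert (Hinj : forall v z, (forall u, rf (R u) v = rf u z) -> z = k0 -> v = k0).
  { intros v z Hz ->. destruct (adjR v) as [z' [_ [<- Hz']]].
    assert (E : z' = k0).
    { apply rf_nondeg. intros w. rewrite rfC, <- Hz', Hz. apply rf0r. }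
    rewrite E. assert (Ek : forall X : Op K, linear_op X -> app X k0 = k0).
    { intros X [X0 [_ XZ]]. destruct (XZ C0 k0 X0) as [_ E']. rewrite !kscal0 in E'. exact E'. }
    rewrite (Ek T LT), (Ek S LS). vec_ring. }
  assert (dens : densely_defined (op_comp S T)).
  { unfold densely_defined. apply dense_of_orthogonal; [exact A0 | intros; apply AD; assumption | intros; apply AZ; assumption |].
    (* [R] takes values in the domain, so a vector orthogonal to the domain is annihilated by [R^+],
       which is injective. *)
    intros y Hy. apply Hinj with k0; [|reflexivity].
    intros u. rewrite rf0r. apply Hy, HR. }
  split; [exact dens|].
  pose proof (adj_is_adjoint _ dens) as HAA.
  (* Writing [u = (S T - lam) (R u)] gives [[u, y] = [R u, z' - conj lam y]], so [y] is [R^+] of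
     that vector and lies in the domain. *)
  assert (Hsub : forall y z, adj_rel (op_comp S T) y z -> dom (op_comp S T) y).
  { intros y z' Hy.
    destruct (adjR (ksub z' (kscal (Cconj lam) y))) as [z [Dz [_ Hz]]].
    replace y with z; [exact Dz|]. apply rf_ext. intros u. rewrite !(rfC K _ u), <- Hz.
    destruct (HR u) as [D E]. rewrite rfBr, <- rf_conj, <- (rf_adj _ _ _ _ Hy D).
    rewrite <- rfBl. simpl. rewrite E. reflexivity. }
  assert (Hsym : forall y, dom (op_comp S T) y -> adj_rel (op_comp S T) y (app (op_comp S T) y)).
  { intros y [Hy Hy']. apply adj_rel_re; [exact LA|]. intros x [Hx Hx']. simpl.
    rewrite (rf_dual S T), (rf_dual T S); auto. }
  split.
  - intros y. split.
    + intros [z Hz]. apply Hsub with z, Hz.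
    + intros Hy. exists (app (op_comp S T) y). apply Hsym, Hy.
  - intros y Hy. assert (Hy' : dom (op_comp S T) y) by (destruct Hy as [z Hz]; apply Hsub with z, Hz).
    apply (HAA y (app (op_comp S T) y)), Hsym, Hy'.
Qed.

End Adjoints.

Theorem theorem2p1 (K : KreinSpace) (T : Op K) :
  linear_op T -> closed_op T -> densely_defined T ->
  resolvent_nonempty (op_comp (adj T) T) ->
  resolvent_nonempty (op_comp T (adj T)) ->
  selfadjoint (op_comp (adj T) T) /\ selfadjoint (op_comp T (adj T)).
Proof.
  intros HT Hcl Hd [lam HA] [mu HB].
  pose proof (adj_is_adjoint K T Hd) as HTS.
  assert (HP : dual_pair K T (adj T)) by (split; [exact HTS | apply double_adjoint; assumption]).
  pose proof (dual_pair_sym K _ _ HP) as HP'.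
  assert (Hcommon : exists nu, in_resolvent (op_comp (adj T) T) nu /\
                               in_resolvent (op_comp T (adj T)) nu).
  { destruct (classic (lam = C0)) as [-> | Hl].
    - destruct (classic (mu = C0)) as [-> | Hm].
      + exists C0. split; assumption.
      + exists mu. split; [|exact HB]. apply resolvent_transfer with C0; assumption.
    - exists lam. split; [exact HA|]. apply resolvent_transfer with mu; assumption. }
  destruct Hcommon as [nu [HA' HB']].
  split; eapply in_resolvent_selfadjoint; eassumption.
Qed.
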